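(* Let $G$ be an infinite, connected, countable graph such that every vertex has degree at most a constant $D$. For any starting vertex and any initial port, the random basic walk on $G$ cycles with probability $1$.
   Context: Each undirected edge $\{v,w\}$ is regarded as two arcs $v\to w$ and $w\to v$. A labeling assigns, at each vertex $v$ of degree $\deg(v)$, the port numbers $1,\dots,\deg(v)$ bijectively to the arcs leaving $v$ (labels on $v\to w$ and $w\to v$ need not agree). In a random labeling these bijections are chosen uniformly at random, independently for different vertices. Given a labeling, a starting vertex $v_0$ and an initial port $\ell$, the basic walk leaves $v_0$ along the arc labeled $\ell$; thereafter, whenever it enters a vertex $v$ along an arc whose label is $i$, it leaves $v$ along the arc out of $v$ labeled $(i \bmod \deg(v))+1$. The random basic walk is the basic walk for a random labeling. The walk cycles if some arc is traversed twice in the same direction (equivalently, from some point on it is periodic and visits only finitely many vertices); it is transient otherwise. *)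

(* Defs.v *)
From HB Require Import structures.
From mathcomp Require Import all_boot all_order all_algebra.
From mathcomp Require Import all_classical all_reals all_analysis.
Set Implicit Arguments. Unset Strict Implicit. Unset Printing Implicit Defensive.
Import Order.TTheory GRing.Theory Num.Theory.
Local Open Scope classical_set_scope.

Section Graph.
Variable V : countType.
Variable nbrs : V -> seq V.

Definition adj : rel V := fun v w => w \in nbrs v.

Definition simple_graph : Prop :=
  [/\ forall v, uniq (nbrs v),
      forall v, v \notin nbrs v &
      forall v w, (w \in nbrs v) = (v \in nbrs w)].

Definition deg (v : V) : nat := size (nbrs v).

Definition connected_graph : Prop :=
  forall u v, exists p : seq V, path adj u p /\ last u p = v.

Definition infinite_graph : Prop := forall s : seq V, exists v, v \notin s.

(* A labeling: at each vertex v, the list L v of the out-neighbours of v,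
   ordered by port number: the arc leaving v with label i (1 <= i <= deg v)
   is v -> nth v (L v) i.-1.  A valid labeling has L v a permutation of
   nbrs v (a bijection between ports 1..deg v and arcs leaving v). *)
Definition valid_labeling (L : V -> seq V) : Prop :=
  forall v, perm_eq (L v) (nbrs v).

(* State of the basic walk: the arc (u, v) just traversed, and its label i
   (the port at u). *)
Definition walk_state := (V * V * nat)%type.

Definition walk_step (L : V -> seq V) (x : walk_state) : walk_state :=
  let: (u, v, i) := x in
  let j := (i %% deg v).+1 in
  (v, nth v (L v) j.-1, j).

Definition walk_start (L : V -> seq V) (v0 : V) (l : nat) : walk_state :=
  (v0, nth v0 (L v0) l.-1, l).

Definition walk_arc (L : V -> seq V) (v0 : V) (l n : nat) : V * V :=
  (iter n (walk_step L) (walk_start L v0 l)).1.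

Definition walk_cycles (L : V -> seq V) (v0 : V) (l : nat) : Prop :=
  exists m n, (m < n)%N /\ walk_arc L v0 l m = walk_arc L v0 l n.

End Graph.

(* A random labeling on a probability space (T, P): lab t is a valid labeling
   for every outcome t, each event {lab v = s} is measurable, and the labels
   at distinct vertices are independent and uniformly distributed:
   for every finite set of distinct vertices vs and every choice of
   permutations s v of nbrs v (v in vs), the probability that
   lab v = s v for all v in vs is the product of the 1/(deg v)!. *)
Definition random_labeling (V : countType) (nbrs : V -> seq V)
  (d : measure_display) (T : measurableType d) (R : realType)
  (P : probability T R) (lab : T -> V -> seq V) : Prop :=
  [/\ forall t, valid_labeling nbrs (lab t),
      forall v s, measurable [set t | lab t v = s] &
      forall (vs : seq V) (s : V -> seq V), uniq vs ->
        (forall v, v \in vs -> perm_eq (s v) (nbrs v)) ->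
        P [set t | forall v, v \in vs -> lab t v = s v] =
        ((\prod_(v <- vs) ((deg nbrs v)`!)%:R^-1 : R)%R)%:E].

(* Main.v *)
(** A transient walk repeats no state (vertex, exit port), so it leaves every
    finite set, and at its first entrance into a large ball around one of its
    far away vertices this whole ball is unexplored.  Inside an unexplored ball
    some labeling of boundedly many vertices makes the walk cycle: a walk that
    uses no arc twice is realised by a labeling until a state is repeated, and
    some such walk must repeat a state.  Indeed, along a path of length [D + 3]
    the degrees cannot strictly increase, so the path contains consecutive
    vertices [c, x, z] with [deg x <= deg c].  Arriving at [c], visit and leave
    each other neighbour of [c], then come back from [x] either directly or
    after the detour [x, z, x].  Now [c] is entered through all its in-arcs, so
    if no state is repeated its last visit uses the only port left in both
    cases, and then the detour came back to [x] with the port it started from.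
    Hence, given any finite set of labels, a transient walk reaches a moment at
    which it cycles with probability at least [eps > 0], where [eps] depends on
    [D] only.  So the conditional probability of transience given finitely many
    labels is at most [(1 - eps) ^+ k], by induction on [k]. *)
Require Import Defs.
From HB Require Import structures.
From mathcomp Require Import all_boot all_order all_algebra.
From mathcomp Require Import all_classical all_reals all_analysis.
From mathcomp Require Import zify.
Set Implicit Arguments. Unset Strict Implicit. Unset Printing Implicit Defensive.
Import Order.TTheory GRing.Theory Num.Theory numFieldNormedType.Exports.
Local Open Scope classical_set_scope.

(** * Lists without repetition and transpositions of their entries *)

Lemma uniq_map_inj_in (T1 T2 : eqType) (f : T1 -> T2) (s : seq T1) :
  uniq (map f s) -> {in s &, injective f}.
Proof.
elim: s => [|a s IHs] //= /andP[fa us] x y.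
rewrite !inE => /predU1P[->|xs] /predU1P[->|ys] // fxy.
- by move: fa; rewrite fxy map_f.
- by move: fa; rewrite -fxy map_f.
- exact: IHs fxy.
Qed.

Section Permutations.
Variable T : eqType.
Implicit Types (s : seq T) (x y : T).

Definition swap_nth x0 s i j : seq T :=
  mkseq (fun k => nth x0 s (if k == i then j else if k == j then i else k))
        (size s).

Lemma perm_swap_nth x0 s i j :
  uniq s -> i < size s -> j < size s -> perm_eq (swap_nth x0 s i j) s.
Proof.
move=> us ltis ltjs.
have lt_sw k : k < size s ->
    (if k == i then j else if k == j then i else k) < size s.
  by move=> ltks; case: ifP => // _; case: ifP.
have usw : uniq (swap_nth x0 s i j).
  apply/mkseq_uniqP => k k'; rewrite !inE => ltk ltk' /eqP.
  rewrite nth_uniq ?lt_sw // => /eqP.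
  by do !case: (_ =P _) => ?; lia.
apply: uniq_perm => //.
have sub : {subset swap_nth x0 s i j <= s}.
  by move=> x /(nthP x0)[k]; rewrite size_mkseq => ltk <-; rewrite nth_mkseq ?mem_nth ?lt_sw.
by have [] := uniq_min_size usw sub _; rewrite ?size_mkseq.
Qed.

End Permutations.

(** * States of the walk, and labelings that realise a given trail *)

Section Walk.
Variables (V : countType) (nbrs : V -> seq V).
Local Notation deg := (deg nbrs).
Local Notation adj := (adj nbrs).
Local Notation valid := (valid_labeling nbrs).
Implicit Types (L : V -> seq V) (st : V * nat) (p : nat) (q S : seq V).

Definition next_port p (w : V) : nat := (p %% deg w).+1.

(** The target [w] is prescribed and not read from a labeling, so the states along a vertex path are
    known before any labeling is chosen. *)
Definition advance st (w : V) : V * nat := (w, next_port st.2 w).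

(* A state [(v, p)] of the walk: it sits at [v] and is about to leave through
   port [p]. *)
Definition port_step L st := advance st (nth st.1 (L st.1) st.2.-1).

Definition position L (v0 : V) (l n : nat) := iter n (port_step L) (v0, l).

Lemma walk_arcE L v0 l n :
  walk_arc nbrs L v0 l n = ((position L v0 l n).1, (position L v0 l n.+1).1).
Proof.
rewrite /walk_arc.
suff -> : iter n (walk_step nbrs L) (walk_start L v0 l) =
  ((position L v0 l n).1, (position L v0 l n.+1).1, (position L v0 l n).2) by [].
elim: n => [|n IHn] //.
by rewrite iterS IHn /position !iterS.
Qed.

Lemma repeat_cycles L v0 l m n : m < n ->
  position L v0 l m = position L v0 l n -> walk_cycles nbrs L v0 l.
Proof.
move=> ltmn eqmn; exists m, n; split=> //.
by rewrite !walk_arcE /position !iterS -/(position L v0 l m) -/(position L v0 l n) eqmn.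
Qed.

Definition port_ok st := (0 < st.2 <= deg st.1).

Hypothesis simpleG : simple_graph nbrs.

Lemma nbrs_uniq v : uniq (nbrs v). Proof. by case: simpleG. Qed.
Lemma nbrs_irr v : (v \in nbrs v) = false.
Proof. by case: simpleG => _ /(_ v)/negbTE. Qed.
Lemma nbrs_sym v w : (w \in nbrs v) = (v \in nbrs w).
Proof. by case: simpleG. Qed.

Lemma deg_gt0 v w : w \in nbrs v -> 0 < deg v.
Proof. by rewrite /deg; case: (nbrs v). Qed.

Lemma port_ok_advance st w : w \in nbrs st.1 -> port_ok (advance st w).
Proof.
rewrite nbrs_sym => /deg_gt0 dw.
by rewrite /port_ok /advance /next_port /= ltn_mod.
Qed.

(** One entry longer than [q]: [zip (states st q) q] pairs each state with the vertex it leaves for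
    and drops the final state. *)
Definition states st q := st :: scanl advance st q.

Lemma states_cat st q1 q2 :
  states st (q1 ++ q2) = states st q1 ++ scanl advance (foldl advance st q1) q2.
Proof. by rewrite /states scanl_cat. Qed.

Lemma map_fst_states st q : map fst (states st q) = st.1 :: q.
Proof.
rewrite /states /=; congr cons.
by elim: q st => //= w q IHq st; rewrite IHq.
Qed.

Lemma size_states st q : size (states st q) = (size q).+1.
Proof. by rewrite /= size_scanl. Qed.

Lemma states_port_ok st q : port_ok st -> path adj st.1 q ->
  {in states st q, forall st', port_ok st'}.
Proof.
elim: q st => [|w q IHq] st okst /=.
  by move=> _ st'; rewrite inE => /eqP->.
move=> /andP[aw pq] st'; rewrite inE => /predU1P[->//|].
by apply: (IHq (advance st w)); rewrite ?port_ok_advance.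
Qed.

Lemma iter_port_step_states L st q :
    (forall r, r \in zip (states st q) q -> nth r.1.1 (L r.1.1) r.1.2.-1 = r.2) ->
  forall i, i <= size q -> iter i (port_step L) st = nth st (states st q) i.
Proof.
elim: q st => [|w q IHq] st Lq [|i] //=; rewrite ltnS => lei.
have stepw : port_step L st = advance st w.
  by rewrite /port_step (Lq (st, w)) // inE eqxx.
rewrite -iterS iterSr stepw IHq //.
  by apply: set_nth_default; rewrite size_states ltnS.
by move=> r rq; apply: Lq; rewrite /= inE rq orbT.
Qed.

(** A triple [(x, p, y)] requests that port [p] of [x] lead to [y]. At each vertex the requests form
    a partial injection; one transposition per request extends it to a bijection. *)
Lemma extend_partial_labeling (Z : seq (V * nat * V)) :
    {in Z, forall r, port_ok r.1 /\ r.2 \in nbrs r.1.1} ->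
    {in Z &, injective (fun r => r.1)} ->
    {in Z &, injective (fun r => (r.1.1, r.2))} ->
  exists2 L, valid L & {in Z, forall r, nth r.1.1 (L r.1.1) r.1.2.-1 = r.2}.
Proof.
elim: Z => [|[[x p] y] Z IHZ] okZ inj1 inj2.
  by exists nbrs => // v; exact: perm_refl.
have subZ r : r \in Z -> r \in (x, p, y) :: Z by move=> rZ; rewrite inE rZ orbT.
case: IHZ => [r /subZ/okZ //|r s /subZ rZ /subZ sZ|r s /subZ rZ /subZ sZ|L vL LZ].
- exact: inj1.
- exact: inj2.
have [okx yx] : port_ok (x, p) /\ y \in nbrs x by apply: (okZ (x, p, y)); rewrite inE eqxx.
have sLx : size (L x) = deg x by rewrite (perm_size (vL x)).
have uLx : uniq (L x) by rewrite (perm_uniq (vL x)) nbrs_uniq.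
have yLx : y \in L x by rewrite (perm_mem (vL x)).
set j := index y (L x).
have ltj : j < size (L x) by rewrite index_mem.
have lti : p.-1 < size (L x) by case/andP: okx => /= p_gt0; rewrite sLx prednK.
exists (fun w => if w == x then swap_nth x (L x) p.-1 j else L w).
  move=> w; case: eqP => [->|_]; last exact: vL.
  exact: perm_trans (perm_swap_nth _ uLx lti ltj) (vL x).
move=> r rZ; move: (rZ); rewrite inE => /predU1P[->|{}rZ'] /=.
  by rewrite eqxx nth_mkseq // eqxx nth_index.
case: eqP => [r1x|_]; last exact: LZ.
have [okr _] := okZ _ rZ.
have ltr : r.1.2.-1 < size (L x) by case/andP: okr => r_gt0; rewrite r1x sLx prednK.
have Lr := LZ _ rZ'; rewrite r1x in Lr.
have xZ : (x, p, y) \in (x, p, y) :: Z by rewrite inE eqxx.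
(* A request of the tail in a moved position can only be [(x, p, y)] itself, by [inj1] at [p.-1] and
   by [inj2] at [j]. *)
rewrite r1x nth_mkseq //; case: eqP => [rp|/eqP nrp].
  rewrite nth_index //.
  have -> // : r = (x, p, y).
  apply: inj1 => //; rewrite [r.1]surjective_pairing r1x /=; congr pair.
  case/andP: okr okx => r_gt0 _ /andP[/= p_gt0 _].
  by rewrite -(prednK r_gt0) -(prednK p_gt0) rp.
case: eqP => [rj|//]; exfalso; move/eqP: nrp; apply.
have eqr : r = (x, p, y).
  by apply: inj2 => //=; rewrite r1x; congr pair; rewrite -Lr rj nth_index.
by rewrite eqr.
Qed.

Definition arcs (v : V) q : seq (V * V) := pairmap pair v q.

Lemma arcs_zip st q : map (fun r => (r.1.1, r.2)) (zip (states st q) q) = arcs st.1 q.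
Proof.
elim: q st => //= w q IHq st.
by have := IHq (advance st w) => /= ->.
Qed.

Lemma zip_take_states st q : zip (states st q) q = zip (take (size q) (states st q)) q.
Proof.
elim: q (states st q) => [|w q IHq] [|a s] //=; by rewrite -IHq.
Qed.

(* A walk using each arc at most once imposes distinct ports on distinct arcs
   as long as its states are distinct, so it is realised by some labeling;
   the first repeated state then closes the walk. *)
Lemma trail_trap st q : port_ok st -> path adj st.1 q -> uniq (arcs st.1 q) ->
    ~~ uniq (states st q) ->
  exists2 L0, valid L0 & forall L, {in st.1 :: q, L =1 L0} ->
    exists m n, m < n /\ iter m (port_step L) st = iter n (port_step L) st.
Proof.
move=> okst; elim/last_ind: q => [|q y IHq] //.
rewrite rcons_path /arcs -cats1 pairmap_cat => /andP[pq yq].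
rewrite cat_uniq => /and3P[uq yNq _].
rewrite states_cat => nu.
(* If a state repeats before the last move, induction applies; otherwise the last state is the one
   that repeats. *)
case: (boolP (uniq (states st q))) => [us|nus]; last first.
  case: (IHq pq uq nus) => L0 vL0 HL0; exists L0 => // L LL0.
  by apply: HL0 => v vq; apply: LL0; rewrite -cat_cons mem_cat vq.
set Z := zip (states st (rcons q y)) (rcons q y).
have path_qy : path adj st.1 (rcons q y) by rewrite rcons_path pq.
(* The state dropped by [zip] is the repeated one, so the states carrying a request are distinct. *)
have Zfst : map (fun r => r.1) Z = states st q.
  rewrite /Z zip_take_states -/(unzip1 _) unzip1_zip ?size_take_min ?geq_minl //.
  by rewrite -[in states _ _]cats1 states_cat take_size_cat // size_states size_rcons.
have Zstates r : r \in Z -> r.1 \in states st q.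
  by rewrite -Zfst; apply: map_f.
have Zarcs : map (fun r => (r.1.1, r.2)) Z = arcs st.1 (rcons q y) by rewrite arcs_zip.
have [|||L0 vL0 LZ] := @extend_partial_labeling Z.
- move=> r rZ; split.
    by apply: (states_port_ok okst pq); exact: Zstates.
  have : (r.1.1, r.2) \in arcs st.1 (rcons q y) by rewrite -Zarcs (map_f _ rZ).
  move: path_qy; rewrite /arcs; elim: (rcons q y) (st.1) => //= w q' IH v /andP[vw pw].
  by rewrite inE => /predU1P[[-> ->] //|]; apply: IH.
- by apply: uniq_map_inj_in; rewrite Zfst.
- by apply: uniq_map_inj_in; rewrite Zarcs /arcs -cats1 pairmap_cat cat_uniq uq yNq.
exists L0 => // L LL0.
have itE := @iter_port_step_states L st (rcons q y) _.
have {itE} itE : forall i, i <= size (rcons q y) ->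
    iter i (port_step L) st = nth st (states st (rcons q y)) i.
  apply: itE => r rZ; rewrite LL0; first exact: LZ.
  have /(map_f fst) := Zstates _ rZ; rewrite map_fst_states cats1 -rcons_cons mem_rcons inE => ->.
  by rewrite orbT.
have : foldl advance st (rcons q y) \in states st q.
  by move: nu; rewrite [scanl _ _ _]/= cats1 rcons_uniq us andbT negbK foldl_rcons.
case/(nthP st) => m; rewrite size_states ltnS => lem eqm.
exists m, (size q).+1; split; first by rewrite ltnS.
rewrite !itE ?size_rcons //; last by rewrite ltnW.
rewrite -cats1 states_cat !nth_cat size_states ltnS lem ltnn subnn /=.
by rewrite eqm foldl_rcons.
Qed.

(** * Trails that must repeat a state *)

Lemma next_port_range st w : w \in nbrs st.1 -> 0 < next_port st.2 w <= deg w.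
Proof. by move=> wst; have := port_ok_advance wst. Qed.

Lemma next_port_inj w p1 p2 : 0 < p1 <= deg w -> 0 < p2 <= deg w ->
  next_port p1 w = next_port p2 w -> p1 = p2.
Proof.
move=> /andP[p1_gt0 le1] /andP[p2_gt0 le2] [].
move: le1 le2; rewrite leq_eqVlt => /predU1P[->|lt1];
  rewrite leq_eqVlt => /predU1P[->|lt2] //.
- by rewrite modnn modn_small // => p20; rewrite -p20 in p2_gt0.
- by rewrite modnn modn_small // => p10; rewrite p10 in p1_gt0.
- by rewrite !modn_small.
Qed.

Lemma mem_arcs v q a b : (a, b) \in arcs v q -> a \in belast v q /\ b \in q.
Proof.
elim: q v => //= w q IHq v; rewrite !inE => /predU1P[[-> ->]|]; first by rewrite !eqxx.
by case/IHq => -> ->; rewrite !orbT.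
Qed.

Lemma uniq_arcs v q : uniq q -> uniq (arcs v q).
Proof.
move=> uq; apply: (@map_uniq _ _ snd).
by rewrite (_ : map snd _ = q) //; elim: q v {uq} => //= w q IHq v; rewrite IHq.
Qed.

Definition star (c : V) (ws : seq V) : seq V := flatten [seq [:: w; c] | w <- ws].

Lemma last_star c ws : last c (star c ws) = c.
Proof. by elim: ws => //= w ws; rewrite -[_ :: _ :: _]/([:: w; c] ++ star c ws) last_cat. Qed.

Lemma arcs_starP c ws a : reflect
  (exists2 w, w \in ws & a = (c, w) \/ a = (w, c)) (a \in arcs c (star c ws)).
Proof.
apply: (iffP idP).
  elim: ws => //= w ws IHws; rewrite !inE => /or3P[/eqP->|/eqP->|/IHws[w' w'ws aE]].
  - by exists w; rewrite ?inE ?eqxx //; left.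
  - by exists w; rewrite ?inE ?eqxx //; right.
  - by exists w'; rewrite // inE w'ws orbT.
elim: ws => [|w ws IHws] [w'] //; rewrite inE => /predU1P[->|w'ws] aE /=.
  by case: aE => ->; rewrite !inE eqxx ?orbT.
by rewrite !inE IHws ?orbT //; exists w'.
Qed.

Lemma uniq_arcs_star c ws : uniq ws -> c \notin ws -> uniq (arcs c (star c ws)).
Proof.
elim: ws => //= w ws IHws /andP[wNws uws]; rewrite !inE negb_or => /andP[cw cNws].
rewrite -/(star c ws) -/(arcs c (star c ws)) IHws // andbT !xpair_eqE (negbTE cw) /=.
apply/andP; split; apply/negP => /arcs_starP[w' w'ws] [] [].
- by move=> ww'; rewrite ww' w'ws in wNws.
- by move=> cw'; rewrite cw' w'ws in cNws.
- by move=> wc; rewrite wc eqxx in cw.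
- by move=> ww'; rewrite ww' w'ws in wNws.
Qed.

Lemma count_mem_star c ws : c \notin ws -> count_mem c (star c ws) = size ws.
Proof.
elim: ws => //= w ws IHws; rewrite inE negb_or => /andP[cw cNws].
by rewrite -/(star c ws) IHws // eqxx eq_sym (negbTE cw).
Qed.

Lemma path_star c ws : {subset ws <= nbrs c} -> path adj c (star c ws).
Proof.
elim: ws => //= w ws IHws sws.
have wc : w \in nbrs c by apply: sws; rewrite inE eqxx.
rewrite {1 2}/adj wc nbrs_sym wc /=; apply: IHws => w' w'ws.
by apply: sws; rewrite inE w'ws orbT.
Qed.

Lemma foldl_advance_fst st q : (foldl advance st q).1 = last st.1 q.
Proof. by elim: q st => //= w q IHq st; rewrite IHq. Qed.

(* Visiting [c] once through each of its in-arcs uses every port of [c]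
   exactly once, unless a state is repeated.  The last visit can be made
   coming back from [x] either directly or after the detour [x -> z -> x], and
   both must use the only port left.  As [deg x <= deg c], this means that the
   detour comes back to [x] with the port it started from. *)
Lemma star_trail st r c x z :
    port_ok st -> path adj st.1 (r ++ [:: c; x; z]) ->
    uniq (st.1 :: r ++ [:: c; x; z]) -> deg x <= deg c ->
  exists q, [/\ path adj st.1 q, uniq (arcs st.1 q), ~~ uniq (states st q),
    {subset q <= r ++ [:: c; x; z] ++ nbrs c} &
    size q <= size r + 2 * deg c + 5].
Proof.
move=> okst ppath upath le_xc.
have [pr uc cx xz] : [/\ path adj st.1 r, adj (last st.1 r) c, adj c x & adj x z].
  by move: ppath; rewrite cat_path /= andbT => /and4P[].
have [cNr xNr zNr] : [/\ c \notin st.1 :: r, x \notin st.1 :: r & z \notin st.1 :: r].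
  move: upath; rewrite -cat_cons cat_uniq => /and3P[_ + _].
  by move=> /hasPn H; split; apply: H; rewrite !inE eqxx ?orbT.
have [cNx cNz xNz] : [/\ c != x, c != z & x != z].
  move: upath; rewrite -cat_cons cat_uniq => /and3P[_ _] /=.
  by rewrite !inE negb_or andbT => /andP[/andP[-> ->] ->].
have ur : uniq r by move: upath; rewrite /= cat_uniq => /and3P[_ ->].
set u := last st.1 r in uc.
have uNx : x != u by apply: contraNneq xNr => ->; rewrite mem_last.
(* All neighbours of [c] except [u], from which the walk first arrives, and [x], from which it
   returns last. *)
pose ws := rem x (rem u (nbrs c)).
have uin : u \in nbrs c by rewrite nbrs_sym.
have mem_ws w : (w \in ws) = [&& w != x, w != u & w \in nbrs c].
  by rewrite mem_rem_uniq ?rem_uniq ?nbrs_uniq // inE mem_rem_uniq ?nbrs_uniq ?inE.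
have uws : uniq ws by rewrite !rem_uniq ?nbrs_uniq.
have cNws : c \notin ws by rewrite mem_ws nbrs_irr !andbF.
have size_ws : (size ws).+2 = deg c.
  have xin : x \in rem u (nbrs c) by rewrite mem_rem_uniq ?nbrs_uniq // inE uNx.
  have : 0 < (size (nbrs c)).-1 by rewrite -(size_rem uin); case: (rem _ _) xin.
  by rewrite /ws size_rem // size_rem // /deg; case: (size _) => [|[]].
pose base := rcons r c ++ star c ws.
have last_base : last st.1 base = c by rewrite last_cat last_rcons last_star.
have path_base : path adj st.1 base.
  rewrite cat_path last_rcons rcons_path pr uc /= path_star //.
  by move=> w; rewrite mem_ws => /and3P[].
(* Proved for the trail with the detour only: the arcs of [base ++ [:: x; c]] form a subsequence. *)
have uniqB : uniq (arcs st.1 (base ++ [:: x; z; x; c])).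
  have Npath a b : a \notin st.1 :: r -> (a, b) \notin arcs st.1 (rcons r c).
    by apply: contra => /mem_arcs[]; rewrite belast_rcons.
  rewrite /arcs pairmap_cat last_base pairmap_cat last_rcons -catA cat_uniq.
  apply/and3P; split.
  - apply: uniq_arcs; rewrite rcons_uniq ur andbT.
    by apply: contra cNr => cr; rewrite inE cr orbT.
  - apply/hasPn => a; rewrite mem_cat => /orP[/arcs_starP[w wws] [] ->|].
    + exact: Npath.
    + rewrite -cats1 pairmap_cat mem_cat /= mem_seq1 xpair_eqE eqxx andbT -/u.
      have /negbTE-> : w != u by move: wws; rewrite mem_ws => /and3P[].
      rewrite orbF; apply/negP => /mem_arcs[_ cr].
      by rewrite inE cr orbT in cNr.
    + by rewrite /= !inE => /or4P[] /eqP ->; exact: Npath.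
  - rewrite cat_uniq uniq_arcs_star // andTb; apply/andP; split; last first.
      rewrite /= !inE !xpair_eqE (negbTE cNx) (negbTE cNz) (negbTE xNz).
      by rewrite [z == c]eq_sym (negbTE cNz) [z == x]eq_sym (negbTE xNz) !eqxx.
    apply/hasPn => a ta; apply/negP => /arcs_starP[w wws] aE; move: ta.
    have wNx : w != x by apply: contraTneq wws => ->; rewrite mem_ws eqxx.
    have wNc : w != c by apply: contraTneq wws => ->.
    rewrite /= !inE; case: aE => ->; rewrite !xpair_eqE.
      by rewrite (negbTE cNx) (negbTE cNz) (negbTE wNx) !andbF.
    by rewrite (negbTE cNx) (negbTE cNz) (negbTE wNx) (negbTE wNc) !andbF.
have xc : adj x c by rewrite /adj nbrs_sym.
have zx : adj z x by rewrite /adj nbrs_sym.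
have sub_base t : {subset t <= [:: c; x; z]} ->
    {subset base ++ t <= r ++ [:: c; x; z] ++ nbrs c}.
  have cin : c \in r ++ [:: c; x; z] ++ nbrs c by rewrite !mem_cat inE eqxx orbT.
  move=> sub_t w; rewrite mem_cat => /orP[|/sub_t wt]; last first.
    by rewrite mem_cat [w \in _ ++ nbrs c]mem_cat wt orbT.
  rewrite mem_cat mem_rcons in_cons -orbA => /or3P[/eqP->//|wr|].
    by rewrite mem_cat wr.
  case/flattenP => s /mapP[w' w'ws ->]; rewrite !inE => /orP[]/eqP->//.
  rewrite mem_cat [w' \in _ ++ nbrs c]mem_cat.
  by move: w'ws; rewrite mem_ws => /and3P[_ _ ->]; rewrite !orbT.
have size_star : size (star c ws) = 2 * size ws.
  by elim: (ws) => //= w ws' IH; rewrite -/(star c ws') IH mulnS.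
have size_base : size base = (size r).+1 + 2 * size ws.
  by rewrite size_cat size_rcons size_star.
case: (boolP (uniq (states st (base ++ [:: x; c])))) => [uA|nuA]; last first.
  exists (base ++ [:: x; c]); split=> //.
  - by rewrite cat_path last_base path_base /= cx xc.
  - move: uniqB; rewrite /arcs !pairmap_cat last_base; apply: subseq_uniq.
    apply: cat_subseq; rewrite //= eqxx.
    by case: ifP => _ //=; case: ifP => _ //=; rewrite eqxx.
  - by apply: sub_base => w; rewrite !inE => /orP[] /eqP ->; rewrite eqxx ?orbT.
  - by rewrite size_cat size_base -size_ws; move: (size r) (size ws); clear => /=; lia.
exists (base ++ [:: x; z; x; c]); split=> //.
- by rewrite cat_path last_base path_base /= cx xz zx xc.
- apply/negP => uB.
  set stc := foldl advance st base.
  have stc1 : stc.1 = c by rewrite foldl_advance_fst.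
  (* Exit ports of the visits to [c] along [base]: one visit from [u] and one from each vertex of
     [ws], [deg c - 1] in all. *)
  pose X := [seq s.2 | s <- states st base & s.1 == c].
  have okX : {in X, forall p, 0 < p <= deg c}.
    move=> p /mapP[s]; rewrite mem_filter => /andP[/eqP <- sst] ->.
    exact: (states_port_ok okst path_base sst).
  have memX p : (p \in X) = ((c, p) \in states st base).
    apply/mapP/idP => [[s]|cp]; last by exists (c, p); rewrite // mem_filter eqxx.
    by rewrite mem_filter => /andP[/eqP <- +] ->; case: s.
  move: uA; rewrite (states_cat st base) -/stc cat_uniq => /and3P[ubase /hasPn NA _].
  move: uB; rewrite (states_cat st base) -/stc cat_uniq => /and3P[_ /hasPn NB utailB].
  have uX : uniq X.
    rewrite map_inj_in_uniq ?filter_uniq // => -[s1 s2] [t1 t2].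
    by rewrite !mem_filter /= => /andP[/eqP-> _] /andP[/eqP-> _] ->.
  have sizeX : (size X).+1 = deg c.
    rewrite size_map size_filter -size_ws; congr S.
    rewrite -(count_map fst (pred1 c)) map_fst_states -cat_cons -rcons_cons.
    rewrite count_cat count_mem_star // -cats1 count_cat (count_memPn cNr) /=.
    by rewrite eqxx.
  pose y1 := next_port stc.2 x.
  pose y2 := next_port (next_port y1 z) x.
  have y1_range : 0 < y1 <= deg x by apply: next_port_range; rewrite stc1.
  have y2_range : 0 < y2 <= deg x by apply: (@next_port_range (z, next_port y1 z)).
  have range_c p : 0 < next_port p c <= deg c.
    exact: (@next_port_range (x, p)).
  have NAX : next_port y1 c \notin X.
    by rewrite memX; apply: NA; rewrite /= !inE /advance /= eqxx orbT.
  have NBX : next_port y2 c \notin X.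
    by rewrite memX; apply: NB; rewrite /= !inE /advance /= eqxx !orbT.
  have eq12 : y1 = y2.
    (* [deg x <= deg c] puts [y1] and [y2] in the range where the shift at [c] is injective;
       different images would give [deg c + 1] ports at [c]. *)
    apply: (@next_port_inj c).
    - by case/andP: y1_range => -> /leq_trans->.
    - by case/andP: y2_range => -> /leq_trans->.
    apply: contraTeq isT => neq12.
    have uXX : uniq [:: next_port y1 c, next_port y2 c & X].
      by rewrite /= inE negb_or neq12 NAX NBX.
    have : size [:: next_port y1 c, next_port y2 c & X] <= size (iota 1 (deg c)).
      apply: uniq_leq_size uXX _ => p; rewrite mem_iota !inE add1n ltnS.
      by case/or3P => [/eqP->|/eqP->|/okX].
    by rewrite size_iota /= sizeX ltnn.
  (* The detour has returned to the state [(x, y1)]. *)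
  move: utailB; rewrite /= !inE /advance /= -/y1 -/y2 -eq12 eqxx.
  by rewrite !orbT.
- by apply: sub_base => w; rewrite !inE => /or4P[] /eqP ->; rewrite eqxx ?orbT.
- by rewrite size_cat size_base -size_ws; move: (size r) (size ws); clear => /=; lia.
Qed.

(** [S] stands for the vertices with known labels. As [W] avoids [S], the labels on [W] are still
    free, and the right choice there closes the walk whatever the labels elsewhere. *)
Definition trappable (M : nat) S st := exists W L0,
  [/\ uniq W, size W <= M, {in W, forall v, v \notin S}, valid L0 &
      forall L, {in W, L =1 L0} ->
        exists m n, m < n /\ iter m (port_step L) st = iter n (port_step L) st].

(** * Trappable states at the start of an unexplored path *)

Variable D : nat.
Hypothesis degD : forall v, deg v <= D.

(** While the degrees strictly increase, removing the first vertex does not lower [size r + deg c];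
    the bound [D] ends this, and the [2] leaves room for [x] and [z]. *)
Lemma degree_drop r c : D + 2 <= size r + deg c ->
  exists r1 c' x z r2, c :: r = r1 ++ [:: c', x, z & r2] /\ deg x <= deg c'.
Proof.
elim: r c => [|x r IHr] c /=; first by have := degD c; lia.
move=> le_size; case: (leqP (deg x) (deg c)) => [le_xc|lt_cx].
  case: r {IHr} le_size => [|z r] /=; first by have := degD c; lia.
  by move=> _; exists [::], c, x, z, r.
have [|r1 [c' [x' [z [r2 [-> le_xc]]]]]] := IHr x; first by lia.
by exists (c :: r1), c', x', z, r2.
Qed.

(** The trail of [star_trail] strays from the path only to neighbours of [c'], and [c'] is taken in
    [q] so that it has a predecessor. *)
Lemma fresh_path_trappable S st q :
    port_ok st -> path adj st.1 q -> uniq (st.1 :: q) -> size q = D.+3 ->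
    {in st.1 :: q, forall v, v \notin S} ->
    (forall v w, v \in q -> w \in nbrs v -> w \notin S) ->
  trappable (3 * D + 6) S st.
Proof.
move=> okst pq uq sq qNS nqNS.
case: q => [//|c q] in sq pq uq qNS nqNS *.
have [|r1 [c' [x [z [r2 [qE le_xc]]]]]] := @degree_drop q c.
  by move: sq => /= [] ->; lia.
rewrite qE in sq pq uq qNS nqNS.
(* [D] bounds the length of [r1], [2 * D] bounds [2 * deg c'], and [6] is the [5] of [star_trail]
   plus the starting vertex. *)
have -> : 3 * D + 6 = D + 2 * D + 6 by lia.
move: sq pq uq; rewrite -[[:: _, _, _ & _]]/([:: c'; x; z] ++ r2) catA.
rewrite cat_path size_cat -cat_cons cat_uniq size_cat /= => sq /andP[p1 _] /andP[u1 _].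
have [q' [pq' uq' nuq' subq' sizeq']] := star_trail okst p1 u1 le_xc.
have [L0 vL0 HL0] := trail_trap okst pq' uq' nuq'.
exists (undup (st.1 :: q')), L0; split=> //.
- exact: undup_uniq.
- by apply: leq_trans (size_undup _) _ => /=; have := degD c'; lia.
- move=> v; rewrite mem_undup inE => /predU1P[->|/subq'].
    by apply: qNS; rewrite inE eqxx.
  rewrite !mem_cat => /or3P[vr|vc|vc].
  + by apply: qNS; rewrite inE mem_cat vr orbT.
  + by apply: qNS; rewrite -[[:: _, _, _ & _]]/([:: c'; x; z] ++ r2) inE !mem_cat vc !orbT.
  + by apply: nqNS vc; rewrite mem_cat inE eqxx orbT.
- by move=> L LL0; apply: HL0 => v vq; apply: LL0; rewrite mem_undup.
Qed.

(** * Balls of the graph *)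

Definition ball (v : V) (k : nat) : seq V :=
  iter k (fun s => s ++ flatten (map nbrs s)) [:: v].

Lemma mem_ballS v k z :
  (z \in ball v k.+1) = (z \in ball v k) || has (fun w => z \in nbrs w) (ball v k).
Proof.
rewrite /ball iterS -/(ball v k) mem_cat; congr orb.
apply/flattenP/hasP => [[s /mapP[w wb ->] zs]|[w wb zw]]; first by exists w.
by exists (nbrs w) => //; exact: map_f.
Qed.

Lemma ball_nbr v k w z : w \in ball v k -> z \in nbrs w -> z \in ball v k.+1.
Proof. by move=> wb zw; rewrite mem_ballS; apply/orP; right; apply/hasP; exists w. Qed.

Lemma ball_leq v k k' : k <= k' -> {subset ball v k <= ball v k'}.
Proof.
move=> /subnKC<-; elim: (k' - k) => [|j IHj] z zb; first by rewrite addn0.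
by rewrite addnS mem_ballS IHj.
Qed.

Lemma ballP v k z :
  reflect (exists q, [/\ path adj v q, last v q = z & size q <= k]) (z \in ball v k).
Proof.
apply: (iffP idP).
  elim: k z => [|k IHk] z; first by rewrite inE => /eqP->; exists [::].
  rewrite mem_ballS => /orP[/IHk[p [pp lp sp]]|/hasP[w /IHk[p [pp lp sp]] zw]].
    by exists p; split=> //; exact: leqW.
  by exists (rcons p z); rewrite rcons_path pp last_rcons size_rcons lp.
case=> p [pp <- sp]; apply: (ball_leq sp).
elim/last_ind: p pp {sp} => [|p w IHp]; first by rewrite inE eqxx.
rewrite rcons_path last_rcons size_rcons => /andP[/IHp + wp].
by move/ball_nbr; apply.
Qed.

Lemma ball_sym v k z : z \in ball v k -> v \in ball z k.
Proof.
move=> /ballP[p [pp <- sp]]; apply/ballP; exists (rev (belast v p)); split.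
- rewrite rev_path (eq_path (e' := adj)) // => x y.
  by rewrite /= /adj nbrs_sym.
- by case: p {pp sp} => //= w p; rewrite rev_cons last_rcons.
- by rewrite size_rev size_belast.
Qed.

(** * A transient walk reaches a trappable state *)

Lemma injective_eventually_notin (T : eqType) (f : nat -> T) (s : seq T) :
  injective f -> exists N, forall n, N <= n -> f n \notin s.
Proof.
move=> injf; elim: s => [|a s [N IHs]]; first by exists 0.
have [[n0 fn0]|nof] := pselect (exists n, f n = a).
  exists (maxn N n0.+1) => n; rewrite geq_max => /andP[leN lt0].
  rewrite inE negb_or IHs // andbT -fn0; apply/eqP => /injf eqn.
  by rewrite eqn ltnn in lt0.
exists N => n leN; rewrite inE negb_or IHs // andbT.
by apply/eqP => fna; apply: nof; exists n.
Qed.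

Lemma port_step_nbrs L st : valid L -> port_ok st -> (port_step L st).1 \in nbrs st.1.
Proof.
move=> vL /andP[p_gt0 lep]; rewrite -(perm_mem (vL st.1)) mem_nth //.
by rewrite (perm_size (vL _)) prednK.
Qed.

Lemma position_ok L v0 l n : valid L -> port_ok (v0, l) -> port_ok (position L v0 l n).
Proof.
move=> vL ok0; elim: n => [|n IHn] //; rewrite /position iterS.
by apply: port_ok_advance; exact: (port_step_nbrs vL IHn).
Qed.

Lemma position_nbrs L v0 l n : valid L -> port_ok (v0, l) ->
  (position L v0 l n.+1).1 \in nbrs (position L v0 l n).1.
Proof. by move=> vL ok0; apply: port_step_nbrs => //; exact: position_ok. Qed.

(** Besides [S], only vertices already left are recorded, those whose labels have been read; the
    current vertex may still be unexplored. *)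
Definition explore L S st n : seq V * (V * nat) :=
  iter n (fun h => (h.2.1 :: h.1, port_step L h.2)) (S, st).

Lemma explore_state L S st n : (explore L S st n).2 = iter n (port_step L) st.
Proof. by elim: n => //= n ->. Qed.

Lemma explored_vertices L S st n v : v \in (explore L S st n).1 ->
  v \in S \/ exists2 i, i < n & v = (iter i (port_step L) st).1.
Proof.
elim: n => [|n IHn]; first by left.
rewrite /= inE -/(explore L S st n) => /predU1P[->|/IHn[vS|[i lti ->]]].
- by right; exists n => //; rewrite explore_state.
- by left.
- by right; exists i => //; exact: ltnW.
Qed.

(* If [v] is a vertex of the walk far from [S], then at the first entrance of
   the walk into a large ball around [v] this whole ball is still unexplored. *)
Lemma transient_trappable L v0 l S :
    valid L -> port_ok (v0, l) -> injective (position L v0 l) ->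
  exists n, let h := explore L S (v0, l) n in trappable (3 * D + 6) h.1 h.2.
Proof.
move=> vL ok0 inj; pose x n := (position L v0 l n).1; pose K := D.+3.
pose far := flatten [seq ball s K | s <- v0 :: S].
(* Ports are at most [D], so only finitely many states lie over [far], and injectivity takes the
   walk out of it. *)
have [N HN] := injective_eventually_notin [seq (s, p) | s <- far, p <- iota 0 D.+1] inj.
have xNfar : x N \notin far.
  apply: contra (HN _ (leqnn N)) => xfar; apply/allpairsP.
  exists (x N, (position L v0 l N).2); split; [exact: xfar | |].
    rewrite mem_iota add0n ltnS leq0n andTb.
    by have /andP[_ /leq_trans->] := position_ok N vL ok0.
  by rewrite /x -surjective_pairing.
set v := x N in xNfar.
have NSball s : s \in v0 :: S -> s \notin ball v K.
  move=> sS; apply: contra xNfar => /ball_sym vs.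
  by apply/flattenP; exists (ball s K) => //; apply/mapP; exists s.
have ex_in : exists n, x n \in ball v K.
  by exists N; apply: (@ball_leq v 0) => //; rewrite inE eqxx.
case: (ex_minnP ex_in) => n xn min_n; exists n => /=.
have freshball w : w \in ball v K -> w \notin (explore L S (v0, l) n).1.
  move=> wb; apply/negP => /explored_vertices[wS|[i lti wE]].
    by have := NSball w; rewrite inE wS orbT wb => /(_ isT).
  by rewrite wE in wb; have := min_n i wb; rewrite leqNgt lti.
have n_gt0 : 0 < n.
  case: n xn {min_n freshball} => [|//] x0.
  by have := NSball v0; rewrite inE eqxx x0 => /(_ isT).
(* At the first entrance the distance to [v] is exactly [K]: any closer, and the previous vertex
   would already be in the ball. *)
have xNball : x n \notin ball v K.-1.
  apply/negP => xn1; have /(_ n.-1) := min_n.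
  rewrite leqNgt prednK // leqnn => H; suff /H : x n.-1 \in ball v K by [].
  apply: ball_nbr xn1 _; rewrite nbrs_sym.
  by have := position_nbrs n.-1 vL ok0; rewrite prednK.
rewrite explore_state -/(position L v0 l n).
have /ballP[p [pp lp sp]] := ball_sym xn.
case/shortenP: pp => q pq uq subq in lp *.
have sq : size q = K.
  apply/eqP; rewrite eqn_leq; apply/andP; split.
    by apply: leq_trans sp; apply: uniq_leq_size => //; case/andP: uq.
  rewrite leqNgt; apply: contra xNball => ltq.
  by apply: ball_sym; apply/ballP; exists q.
(* From index [1] on, the path is so close to [v] that neighbours of its vertices stay in the ball
   too. *)
have qball i : i <= K -> nth v (x n :: q) i \in ball v (K - i).
  move=> lei; apply: ball_sym; apply/ballP; exists (drop i q).
  have := pq; rewrite -{1}(cat_take_drop i q) cat_path => /andP[_ pd].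
  have lastE : last (x n) (take i q) = nth v (x n :: q) i.
    rewrite (last_nth v) size_takel ?sq //.
    by case: i lei {pd} => //= i lei; rewrite nth_take.
  split; first by rewrite -lastE.
  - rewrite -lastE -lp -{3}(cat_take_drop i q) last_cat //.
  - by rewrite size_drop sq.
have mem_q w : w \in x n :: q -> exists2 i, i <= K & w = nth v (x n :: q) i.
  by move=> /(nthP v)[i]; rewrite /= sq ltnS => lei <-; exists i.
apply: (fresh_path_trappable (q := q)) => //.
- exact: position_ok.
- move=> w /mem_q[i lei ->]; apply: freshball.
  by apply: (ball_leq (leq_subr i K)); exact: qball.
- move=> w y /(nthP v)[i]; rewrite sq => lti <- yw; apply: freshball.
  have := ball_nbr (qball i.+1 lti) yw.
  by apply: ball_leq; rewrite subnSK // leq_subr.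
Qed.

Lemma explore_subset L S st m n : m <= n ->
  {subset (explore L S st m).1 <= (explore L S st n).1}.
Proof.
move=> /subnKC<-; elim: (n - m) => [|k IHk] v vm; first by rewrite addn0.
by rewrite addnS /explore iterS inE IHk ?orbT.
Qed.

(** The exploration reads labels only at vertices that it records. *)
Lemma explore_eq_in L L' S st n : {in (explore L S st n).1, L' =1 L} ->
  forall m, m <= n -> explore L' S st m = explore L S st m.
Proof.
move=> LL'; elim=> [|m IHm] // ltmn.
rewrite /explore !iterS -!/(explore _ S st m) IHm; last exact: ltnW.
congr pair; rewrite /port_step LL' //.
by apply: (explore_subset ltmn); rewrite /explore iterS inE eqxx.
Qed.

End Walk.

(** * Measurability of maps into countable types *)

Section DiscretelyMeasurable.
Variables (d : measure_display) (T : measurableType d).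

Definition discretely_measurable (J : countType) (f : T -> J) :=
  forall j, measurable (f @^-1` [set j]).

Lemma discretely_measurable_preimage (J : countType) (f : T -> J) (Q : set J) :
  discretely_measurable f -> measurable (f @^-1` Q).
Proof.
move=> mf; have -> : f @^-1` Q = \bigcup_j (f @^-1` [set j] `&` [set _ | Q j]).
  by apply/seteqP; split=> [t Qt|t [j _ [/= -> //]]]; exists (f t).
apply: countable_bigcupT_measurable => [|j]; first exact: countableP.
have [Qj|nQj] := pselect (Q j).
  by rewrite (_ : [set _ | _] = setT) ?setIT //; apply/seteqP; split.
by rewrite (_ : [set _ | _] = set0) ?setI0 //; apply/seteqP; split.
Qed.

(** Serves to read the label at a vertex that is itself random, such as the current vertex of the
    walk. *)
Lemma discretely_measurable_bind (I J : countType) (f : T -> I) (g : I -> T -> J) :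
    discretely_measurable f -> (forall i, discretely_measurable (g i)) ->
  discretely_measurable (fun t => g (f t) t).
Proof.
move=> mf mg j.
have -> : (fun t => g (f t) t) @^-1` [set j] =
    \bigcup_i (f @^-1` [set i] `&` g i @^-1` [set j]).
  by apply/seteqP; split=> [t gt|t [i _ [/= -> //]]]; exists (f t).
apply: countable_bigcupT_measurable => [|i]; first exact: countableP.
by apply: measurableI; [exact: mf | exact: mg].
Qed.

Lemma discretely_measurable_comp (I J : countType) (f : T -> I) (h : I -> J) :
  discretely_measurable f -> discretely_measurable (h \o f).
Proof.
by move=> mf j; exact: (discretely_measurable_preimage (h @^-1` [set j]) mf).
Qed.

Lemma discretely_measurable_pair (I J : countType) (f : T -> I) (g : T -> J) :
    discretely_measurable f -> discretely_measurable g ->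
  discretely_measurable (fun t => (f t, g t)).
Proof.
move=> mf mg; apply: (discretely_measurable_bind (g := fun i t => (i, g t)) mf) => i.
exact: discretely_measurable_comp mg.
Qed.

(** Takes the place of conditioning on [f]: a bound on each fibre is summed over the countable
    partition. *)
Lemma le_measure_discrete_partition (R : realType) (P : {measure set T -> \bar R}%R)
    (J : countType) (f : T -> J) (A B : set T) (x : R) :
    discretely_measurable f -> measurable A -> measurable B -> (0 <= x)%R ->
    (forall j, (P (A `&` f @^-1` [set j]) <= x%:E * P (B `&` f @^-1` [set j]))%E) ->
  (P A <= x%:E * P B)%E.
Proof.
move=> mf mA mB x0 le_fibre.
(* Fibres are indexed by their codes in [nat] for countable additivity; a number coding nothing
   gives the empty set. *)
pose F n := [set t | pickle (f t) = n].
have mF n : measurable (F n).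
  exact: (discretely_measurable_preimage [set j | pickle j = n] mf).
have sumF C : measurable C -> P C = (\sum_(0 <= n <oo) P (C `&` F n))%E.
  move=> mC; have CE : C = \bigcup_n (C `&` F n).
    by apply/seteqP; split=> [t Ct|t [n _ []//]]; exists (pickle (f t)).
  rewrite {1}CE measure_semi_bigcup //; last by rewrite -CE.
    by move=> n; exact: measurableI.
  by move=> m n _ _ [t [[_ /= <-] [_ /= <-]]].
rewrite (sumF A) // (sumF B) // -nneseriesZl //.
apply: lee_nneseries => // n _.
have [[j jn]|noj] := pselect (exists j : J, pickle j = n).
  suff -> : F n = f @^-1` [set j] by [].
  apply/seteqP; split=> t; last by rewrite /F /= => ->.
  by rewrite /F /= -jn => /(pcan_inj (@pickleK J)).
suff -> : F n = set0 by rewrite !setI0 measure0 mule0.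
by apply/seteqP; split=> t //= ft; apply: noj; exists (f t).
Qed.

End DiscretelyMeasurable.

(** * Events that fix finitely many labels of a random labeling *)

Section RandomLabeling.
Variables (V : countType) (nbrs : V -> seq V) (D : nat).
Variables (d : measure_display) (T : measurableType d) (R : realType).
Variables (P : probability T R) (lab : T -> V -> seq V).
Hypothesis simpleG : simple_graph nbrs.
Hypothesis degD : forall v, deg nbrs v <= D.
Hypothesis labP : random_labeling nbrs P lab.
Variables (v0 : V) (l : nat).
Hypothesis l_ok : port_ok nbrs (v0, l).

Implicit Types (S W : seq V) (t : T).

Let lab_valid t : valid_labeling nbrs (lab t). Proof. by case: labP. Qed.

(** Conditional bounds given the labels on [S] are stated multiplied by the probability of this
    event, so that no division occurs. *)
Definition cylinder S t0 := [set t | {in S, lab t =1 lab t0}].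

Definition labeled W (L : V -> seq V) := [set t | {in W, lab t =1 L}].

Lemma measurable_lab v : discretely_measurable (fun t => lab t v : seq V).
Proof. by move=> s; case: labP => _ /(_ v s). Qed.

Lemma measurable_labs S : discretely_measurable (fun t => map (lab t) S).
Proof.
elim: S => [|v S IHS] /=.
  move=> s; have [<-|ns] := pselect ([::] = s).
    by rewrite (_ : _ @^-1` _ = setT) //; apply/seteqP; split.
  by rewrite (_ : _ @^-1` _ = set0) //; apply/seteqP; split.
have := discretely_measurable_pair (@measurable_lab v) IHS.
exact: (discretely_measurable_comp (fun p => p.1 :: p.2)).
Qed.

Lemma labeledE W L : labeled W L = (fun t => map (lab t) W) @^-1` [set map L W].
Proof. by apply/seteqP; split=> t /= /eq_in_map. Qed.

Lemma measurable_labeled W L : measurable (labeled W L).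
Proof. by rewrite labeledE; exact: measurable_labs. Qed.

Lemma cylinder_eq S t0 t1 : cylinder S t0 t1 -> cylinder S t0 = cylinder S t1.
Proof.
move=> t01; apply/seteqP; split=> t tt v vS; first by rewrite tt // t01.
by rewrite tt // t01.
Qed.

(** [W] and [undup S] form one list of distinct vertices, and its product formula splits. *)
Lemma probability_cylinder_labeled S t0 W L :
    uniq W -> {in W, forall v, v \notin S} -> valid_labeling nbrs L ->
  P (cylinder S t0 `&` labeled W L) =
  ((\prod_(v <- W) ((deg nbrs v)`!)%:R^-1 : R)%R%:E * P (cylinder S t0))%E.
Proof.
move=> uW WNS vL.
have [_ _ Pprod] := labP.
have PS : P (cylinder S t0) = (\prod_(v <- undup S) ((deg nbrs v)`!)%:R^-1 : R)%R%:E.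
  rewrite -(Pprod _ (lab t0) (undup_uniq S) (fun v _ => lab_valid t0 v)).
  by congr (P _); apply/seteqP; split=> t tt v vS; apply: tt; rewrite mem_undup in vS *.
transitivity (P [set t | forall v, v \in W ++ undup S ->
    lab t v = (if v \in W then L v else lab t0 v)]).
  congr (P _); apply/seteqP; split=> [t [tS tW] v|t tt].
    rewrite mem_cat mem_undup; case: ifPn => [vW _|_ /= vS]; first exact: tW.
    exact: tS.
  split=> v vS; last by rewrite tt ?mem_cat ?vS.
  rewrite tt ?mem_cat ?mem_undup ?vS ?orbT //; case: ifPn => // /WNS.
  by rewrite vS.
rewrite Pprod.
- by rewrite big_cat EFinM PS.
- rewrite cat_uniq uW undup_uniq andbT /=; apply/hasPn => v.
  by rewrite mem_undup; apply: contraL => /WNS.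
- by move=> v _; case: ifP => _; [exact: vL | exact: lab_valid].
Qed.

Lemma measurable_explore S n :
  discretely_measurable (fun t => explore nbrs (lab t) S (v0, l) n).
Proof.
elim: n => [|n IHn].
  move=> h; have [<-|nh] := pselect ((S, (v0, l)) = h).
    by rewrite (_ : _ @^-1` _ = setT) //; apply/seteqP; split.
  by rewrite (_ : _ @^-1` _ = set0) //; apply/seteqP; split.
apply: (discretely_measurable_bind
  (g := fun h t => (h.2.1 :: h.1, port_step nbrs (lab t) h.2)) IHn) => h.
exact: (discretely_measurable_comp (fun s : seq V =>
  (h.2.1 :: h.1, advance nbrs h.2 (nth h.2.1 s h.2.2.-1))) (@measurable_lab h.2.1)).
Qed.

(** * Stopping at the first trappable moment *)

Let M := 3 * D + 6.

Definition stops S t n : bool :=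
  let h := explore nbrs (lab t) S (v0, l) n in `[< trappable nbrs M h.1 h.2 >].

Definition stopping_time S t : option nat :=
  if pselect (exists n, stops S t n) is left ex then Some (ex_minn ex) else None.

Lemma stopping_time_Some S t n : stopping_time S t = Some n <->
  stops S t n /\ forall m, stops S t m -> n <= m.
Proof.
rewrite /stopping_time; case: pselect => [ex|nex]; last first.
  by split=> // -[sn _]; case: nex; exists n.
case: ex_minnP => k sk mink; split=> [[<-] //|[sn minn]].
by congr Some; apply/eqP; rewrite eqn_leq mink // minn.
Qed.

Lemma measurable_stops S n : measurable [set t | stops S t n].
Proof.
exact: (discretely_measurable_preimage
  [set h | `[< trappable nbrs M h.1 h.2 >]] (@measurable_explore S n)).
Qed.

Lemma measurable_stopping_time S : discretely_measurable (stopping_time S).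
Proof.
move=> [n|].
  have -> : stopping_time S @^-1` [set Some n] = [set t | stops S t n] `&`
      \bigcap_m [set t | stops S t m -> n <= m].
    apply/seteqP; split=> t /=.
      by move/stopping_time_Some => [sn mn]; split=> // m _; exact: mn.
    by move=> [sn mn]; apply/stopping_time_Some; split=> // m; exact: mn.
  apply: measurableI; first exact: measurable_stops.
  apply: bigcapT_measurable => m; case: (leqP n m) => [le_nm|lt_mn].
    by rewrite (_ : [set _ | _] = setT) //; apply/seteqP; split.
  rewrite (_ : [set _ | _] = ~` [set t | stops S t m]).
    by apply: measurableC; exact: measurable_stops.
  apply/seteqP; split=> t /= sm; first by move/sm.
  by move/sm.
have -> : stopping_time S @^-1` [set None] = ~` \bigcup_n [set t | stops S t n].
  apply/seteqP; split=> t /=; rewrite /stopping_time; case: pselect => // nex.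
    by move=> _ [n _ sn]; apply: nex; exists n.
  by move=> nst; case: nst; case: nex => n sn; exists n.
by apply: measurableC; apply: bigcupT_measurable => n; exact: measurable_stops.
Qed.

(** Labels are recorded with the explored vertices so that conditioning on the data gives cylinders
    again. *)
Definition stopping_data S t : option (seq V * seq (seq V)) :=
  if stopping_time S t is Some n then
    let h := explore nbrs (lab t) S (v0, l) n in Some (h.1, map (lab t) h.1)
  else None.

Lemma measurable_stopping_data S : discretely_measurable (stopping_data S).
Proof.
apply: (discretely_measurable_bind (g := fun o t => if o is Some n then
    let h := explore nbrs (lab t) S (v0, l) n in Some (h.1, map (lab t) h.1)
  else None) (@measurable_stopping_time S)) => -[n|]; last first.
  move=> o; have [<-|no] := pselect (None = o).
    by rewrite (_ : _ @^-1` _ = setT) //; apply/seteqP; split.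
  by rewrite (_ : _ @^-1` _ = set0) //; apply/seteqP; split.
apply: (discretely_measurable_bind (g := fun h t => Some (h.1, map (lab t) h.1))
  (@measurable_explore S n)) => h.
exact: (discretely_measurable_comp (fun ls => Some (h.1, ls))
  (@measurable_labs h.1)).
Qed.

(** Stopping by time [n] depends only on labels already read: agreement on them reproduces the
    exploration and the time [n]. *)
Lemma stopping_data_fibre S t0 n : stopping_time S t0 = Some n ->
  cylinder S t0 `&` stopping_data S @^-1` [set stopping_data S t0] =
  cylinder (explore nbrs (lab t0) S (v0, l) n).1 t0.
Proof.
move=> t0n; set S' := (explore _ _ _ _ n).1.
apply/seteqP; split=> [t [_] /=|t tS'].
  rewrite /stopping_data t0n -/S'; case: (stopping_time S t) => [m|//] [->].
  by move/eq_in_map.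
have exE m : m <= n ->
    explore nbrs (lab t) S (v0, l) m = explore nbrs (lab t0) S (v0, l) m.
  exact: explore_eq_in tS' _.
split=> [v vS|/=].
  by apply: tS'; apply: (@explore_subset _ nbrs (lab t0) S (v0, l) 0 n).
have tn : stopping_time S t = Some n.
  move: t0n; rewrite !stopping_time_Some => -[sn mn].
  split; first by rewrite /stops exE.
  move=> m; case: (leqP n m) => // lt_mn; rewrite /stops exE; last exact: ltnW.
  by move=> /mn; rewrite leqNgt lt_mn.
by rewrite /stopping_data t0n tn exE // -/S'; congr (Some (_, _)); apply/eq_in_map.
Qed.

(** * Transience has probability zero *)

Definition transient := [set t | ~ walk_cycles nbrs (lab t) v0 l].

Lemma measurable_walk_cycles : measurable [set t | walk_cycles nbrs (lab t) v0 l].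
Proof.
have -> : [set t | walk_cycles nbrs (lab t) v0 l] = \bigcup_m \bigcup_n
    [set t | m < n /\ walk_arc nbrs (lab t) v0 l m = walk_arc nbrs (lab t) v0 l n].
  apply/seteqP; split=> [t [m [n mn]]|t [m _ [n _ mn]]]; last by exists m, n.
  by exists m => //; exists n.
apply: bigcupT_measurable => m; apply: bigcupT_measurable => n.
have mpos k : discretely_measurable (fun t => (position nbrs (lab t) v0 l k).1).
  have := discretely_measurable_comp (fun h : seq V * (V * nat) => h.2.1)
    (@measurable_explore [::] k).
  congr discretely_measurable; apply/funext => t /=.
  by rewrite explore_state.
have marc k : discretely_measurable (fun t => walk_arc nbrs (lab t) v0 l k).
  under [X in discretely_measurable X]eq_fun do rewrite walk_arcE.
  exact: discretely_measurable_pair.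
exact: (discretely_measurable_preimage [set a | m < n /\ a.1 = a.2]
  (discretely_measurable_pair (marc m) (marc n))).
Qed.

Lemma measurable_transient : measurable transient.
Proof. exact: measurableC measurable_walk_cycles. Qed.

Lemma transient_stops t : transient t -> forall S, exists n, stopping_time S t = Some n.
Proof.
move=> tr S.
have inj : injective (position nbrs (lab t) v0 l).
  move=> m n eqmn; case: (ltngtP m n) => // lt; case: tr.
    exact: repeat_cycles lt eqmn.
  by apply: repeat_cycles lt _.
have [n sn] := transient_trappable simpleG degD S (lab_valid t) l_ok inj.
have ex : exists n, stops S t n by exists n; apply/asboolP.
rewrite /stopping_time; case: pselect => // ex'.
by exists (ex_minn ex').
Qed.

(** The [eps] of the bound: each of at most [M] vertices receives its prescribed labels with
    probability at least [1 / D!]. *)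
Let c : R := ((D`!)%:R^-1 ^+ M)%R.

Lemma trap_probability_le W : size W <= M ->
  (c <= \prod_(v <- W) ((deg nbrs v)`!)%:R^-1)%R.
Proof.
move=> sW; have fD : (0 < (D`!)%:R :> R)%R by rewrite ltr0n fact_gt0.
have i_ge0 : (0 <= (D`!)%:R^-1 :> R)%R by rewrite invr_ge0 ltW.
have i_le1 : ((D`!)%:R^-1 <= 1 :> R)%R by rewrite invf_le1 // ler1n fact_gt0.
apply: (@le_trans _ _ ((D`!)%:R^-1 ^+ size W)%R); first exact: ler_wiXn2l.
elim: W {sW} => [|v W IHW]; first by rewrite big_nil.
rewrite big_cons exprS; apply: ler_pM; rewrite // ?exprn_ge0 //.
rewrite lef_pV2 ?posrE ?ltr0n ?fact_gt0 // ler_nat.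
exact: leq_fact.
Qed.

Lemma trap_probability_gt0 : (0 < c)%R.
Proof. by rewrite exprn_gt0 // invr_gt0 ltr0n fact_gt0. Qed.

Lemma trap_probability_le1 : (c <= 1)%R.
Proof. by have := @trap_probability_le [::] isT; rewrite big_nil. Qed.

(** A transient outcome must differ from [L] somewhere on [W], which costs a factor [1 - c]; the
    hypothesis for [k] applies once the labels on [W] are revealed too. *)
Lemma transient_stopped_le k S t1 n :
    (forall S' t, P (transient `&` cylinder S' t) <=
      ((1 - c) ^+ k)%R%:E * P (cylinder S' t))%E ->
    stopping_time S t1 = Some n ->
  (P (transient `&` cylinder (explore nbrs (lab t1) S (v0, l) n).1 t1) <=
   ((1 - c) ^+ k.+1)%R%:E * P (cylinder (explore nbrs (lab t1) S (v0, l) n).1 t1))%E.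
Proof.
move=> IHk /stopping_time_Some[/asboolP[W [L [uW sW WNS vL trapL]]] _].
set S1 := (explore nbrs (lab t1) S (v0, l) n).1.
have mtr := measurable_transient.
have mC : measurable (cylinder S1 t1) by exact: measurable_labeled.
have mW : measurable (labeled W L) by exact: measurable_labeled.
have c1_ge0 : (0 <= 1 - c)%R by rewrite subr_ge0 trap_probability_le1.
have trapped t : cylinder S1 t1 t -> labeled W L t -> ~ transient t.
  move=> tS1 tW ntr; apply: ntr.
  have /trapL[i [j [lt_ij]]] := tW.
  rewrite -(explore_eq_in tS1 (leqnn n)) explore_state -!iterD => eq_ij.
  by apply: (@repeat_cycles _ _ _ _ _ (i + n) (j + n)); rewrite // ltn_add2r.
have le_minus : (P (transient `&` cylinder S1 t1) <=
    ((1 - c) ^+ k)%R%:E * P (cylinder S1 t1 `\` labeled W L))%E.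
  apply: (le_measure_discrete_partition (@measurable_labs W)).
  - exact: measurableI.
  - exact: measurableD.
  - exact: exprn_ge0.
  move=> ls; set fibre := _ @^-1` _.
  have [[t2 [[tr2 t2S1] t2ls]]|empty] :=
      pselect (exists t, (transient `&` cylinder S1 t1) t /\ fibre t); last first.
    rewrite (_ : _ `&` fibre = set0).
      by rewrite measure0 mule_ge0 // lee_fin exprn_ge0.
    by apply/seteqP; split=> t // [? ?]; apply: empty; exists t.
  have {}t2ls : map (lab t2) W = ls := t2ls.
  have fibreE : fibre = labeled W (lab t2) by rewrite labeledE t2ls.
  have catE : cylinder S1 t1 `&` fibre = cylinder (S1 ++ W) t2.
    rewrite fibreE (cylinder_eq t2S1); apply/seteqP; split=> [t [tS tW] v|t tSW].
      by rewrite mem_cat => /orP[/tS|/tW].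
    by split=> v vS; apply: tSW; rewrite mem_cat vS ?orbT.
  (* The fibre contains the transient outcome [t2], so its labels on [W] are not those of [L], and
     it avoids [labeled W L] entirely. *)
  rewrite -setIA catE (_ : _ `&` fibre = cylinder (S1 ++ W) t2); first exact: IHk.
  rewrite -catE; apply/seteqP; split=> [t [[tS _] tf] //|t [tS tf]].
  split=> //; split=> // tW; move: tf; rewrite fibreE => tt2.
  by apply: (trapped t2) => // v vW; rewrite -tt2 // tW.
apply: (le_trans le_minus); rewrite exprSr EFinM -muleA.
apply: lee_wpmul2l; first by rewrite lee_fin exprn_ge0.
have fC : (P (cylinder S1 t1) < +oo)%E by rewrite ltey_eq fin_num_measure.
have -> : P (cylinder S1 t1 `\` labeled W L) = (P (cylinder S1 t1) -
    (\prod_(v <- W) ((deg nbrs v)`!)%:R^-1 : R)%R%:E * P (cylinder S1 t1))%E.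
  by rewrite -(probability_cylinder_labeled t1 uW WNS vL); exact: measureD.
have : P (cylinder S1 t1) \is a fin_num by exact: fin_num_measure.
have : (0 <= P (cylinder S1 t1))%E by [].
case: (P (cylinder S1 t1)) => // p; rewrite lee_fin => p_ge0 _.
rewrite -!EFinM -EFinB lee_fin -[X in (X - _)%R]mul1r -mulrBl.
by rewrite ler_wpM2r // lerB // trap_probability_le.
Qed.

Lemma transient_cylinder_le k S t0 :
  (P (transient `&` cylinder S t0) <= ((1 - c) ^+ k)%R%:E * P (cylinder S t0))%E.
Proof.
elim: k S t0 => [|k IHk] S t0.
  have mC : measurable (cylinder S t0) by exact: measurable_labeled.
  rewrite expr0 mul1e; apply: le_measure; rewrite ?inE //.
  by apply: measurableI => //; exact: measurable_transient.
have c1_ge0 : (0 <= 1 - c)%R by rewrite subr_ge0 trap_probability_le1.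
(* Fibres without transient outcomes contribute nothing; on the others the walk stops, and the part
   in [cylinder S t0] is a cylinder over the explored vertices. *)
apply: (le_measure_discrete_partition (@measurable_stopping_data S)).
- by apply: measurableI; [exact: measurable_transient | exact: measurable_labeled].
- exact: measurable_labeled.
- exact: exprn_ge0.
move=> o; set fibre := _ @^-1` _.
have [[t1 [[tr1 t1S] t1o]]|empty] :=
    pselect (exists t, (transient `&` cylinder S t0) t /\ fibre t); last first.
  rewrite (_ : _ `&` fibre = set0).
    by rewrite measure0 mule_ge0 // lee_fin exprn_ge0.
  by apply/seteqP; split=> t // [? ?]; apply: empty; exists t.
have {}t1o : stopping_data S t1 = o := t1o.
have [n t1n] := transient_stops tr1 S.
have fibreE : cylinder S t0 `&` fibre = cylinder (explore nbrs (lab t1) S (v0, l) n).1 t1.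
  by rewrite (cylinder_eq t1S) -(stopping_data_fibre t1n) t1o.
rewrite -setIA fibreE.
exact: transient_stopped_le.
Qed.

Lemma transient_null : P transient = 0%E.
Proof.
(* Total mass [1] provides an outcome to name the cylinder over [[::]], which is the whole space. *)
have [t0] : exists t0 : T, True.
  have [//|noT] := pselect (exists t0 : T, True).
  have := @probability_setT _ _ _ P.
  rewrite (_ : setT = set0) ?measure0; last first.
    by apply/seteqP; split=> t // _; apply: noT; exists t.
  by move/eqP; rewrite eqe eq_sym oner_eq0.
move=> _.
have c_gt0 := trap_probability_gt0; have c_le1 := trap_probability_le1.
have leP k : (P transient <= ((1 - c) ^+ k)%R%:E)%E.
  have := transient_cylinder_le k [::] t0.
  rewrite (_ : cylinder [::] t0 = setT); last by apply/seteqP; split.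
  by rewrite setIT probability_setT mule1.
have fP : P transient \is a fin_num by rewrite fin_num_measure //; exact: measurable_transient.
have P_ge0 : (0 <= P transient)%E by [].
move: fP leP P_ge0; case: (P transient) => // p _ leP.
rewrite lee_fin => p_ge0; congr (_%:E); apply/eqP; rewrite eq_le p_ge0 andbT.
have cvg0 : ((fun k => (1 - c) ^+ k)%R : R^nat) @ \oo --> (0 : R)%R.
  rewrite (_ : (fun _ => _) = geometric 1%R (1 - c)%R).
    by apply: cvg_geometric; rewrite ger0_norm ?subr_ge0 // ltrBlDr ltrDl.
  by apply/funext => k; rewrite /geometric /= mul1r.
rewrite -(cvg_lim _ cvg0) //; apply: limr_ge; first exact: cvgP cvg0.
by apply: nearW => k; rewrite -lee_fin.
Qed.

End RandomLabeling.

Theorem theorem4p7 (V : countType) (nbrs : V -> seq V) (D : nat)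
  (d : measure_display) (T : measurableType d) (R : realType)
  (P : probability T R) (lab : T -> V -> seq V) :
  simple_graph nbrs ->
  infinite_graph V ->
  connected_graph nbrs ->
  (forall v, deg nbrs v <= D) ->
  random_labeling nbrs P lab ->
  forall (v0 : V) (l : nat), 1 <= l <= deg nbrs v0 ->
    P [set t | walk_cycles nbrs (lab t) v0 l] = 1%E.
Proof.
move=> simpleG _ _ degD labP v0 l l_ok.
rewrite -[X in P X]setCK probability_setC.
  by rewrite (transient_null simpleG degD labP l_ok) sube0.
exact: (measurable_transient labP).
Qed.
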